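(* Let $\mathcal{G}=(G_{[1]},\dots,G_{[N]})$ be a time-evolving network on the node set $[n]$ with time-evolving adjacency matrix $\mathcal{A}\in\mathbb{R}^{nN\times nN}$. Let $f(z)=\sum_{k=0}^\infty c_k z^k$ be an analytic function all of whose coefficients satisfy $c_k\ge 0$, with radius of convergence $r$. Let $1\le\tau_1\le\tau_2\le N$ and let $t$ be an attenuation factor with $0<t<r/\rho(\mathcal{A})$, where $\rho$ denotes the spectral radius. Then, for every node $i\in[n]$, the $f$-centrality (with parameter $t$) of node $i$ in the time-evolving subnetwork $(G_{[\tau_1]},\dots,G_{[\tau_2]})$ is equal to $$\sum_{j=n(\tau_1-1)+1}^{\tau_2 n}\,[f(t\mathcal{A})]_{(\tau_1-1)n+i,\;j}.$$
   Context: A finite time-evolving network $\mathcal{G}=(G_{[1]},\dots,G_{[N]})$ on $V=[n]=\{1,\dots,n\}$ is a finite sequence of weighted digraphs $G_{[s]}=(V,E_{[s]})$, $E_{[s]}\subseteq V\times V$ (loops allowed), with weight functions $\omega_{[s]}:E_{[s]}\to\mathbb{R}_{>0}$. The adjacency matrix $A_{[s]}\in\mathbb{R}^{n\times n}$ has $(v,w)$ entry $\omega_{[s]}(v,w)$ if $(v,w)\in E_{[s]}$ and $0$ otherwise. The time-evolving adjacency matrix $\mathcal{A}\in\mathbb{R}^{nN\times nN}$ is the block upper-triangular matrix, with $n\times n$ blocks, whose $(r,s)$ block is $A_{[s]}$ if $r\le s$ and $0$ if $r>s$ ($1\le r,s\le N$). A walk of length $k\ge1$ in a time-evolving network is a sequence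 of nodes $i_1i_2\dots i_{k+1}$ together with time frames $\sigma_1\le\sigma_2\le\dots\le\sigma_k$ of that network such that $(i_\ell,i_{\ell+1})\in E_{[\sigma_\ell]}$ for $\ell=1,\dots,k$; its weight is $\prod_{\ell=1}^{k}\omega_{[\sigma_\ell]}(i_\ell,i_{\ell+1})$. For each node there is exactly one walk of length $0$ departing from it, of weight $1$. For the subnetwork $(G_{[\tau_1]},\dots,G_{[\tau_2]})$, walks use only time frames in $\{\tau_1,\dots,\tau_2\}$. The $f$-centrality of node $i$ with parameter $t$ is the sum, over all $k\ge0$ and all walks of length $k$ in the network departing from node $i$, of $c_kt^k$ times the weight of the walk. Here $f(t\mathcal{A})=\sum_{k\ge0}c_kt^k\mathcal{A}^k$, and $r/\rho(\mathcal{A})=\infty$ if $\rho(\mathcal{A})=0$ or $r=\infty$. *)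

(* Defs.v *)
From HB Require Import structures.
From mathcomp Require Import all_boot all_order all_algebra.
From mathcomp Require Import all_classical all_reals all_analysis.
From mathcomp Require Import complex.
Set Implicit Arguments.
Unset Strict Implicit.
Unset Printing Implicit Defensive.
Import Order.TTheory GRing.Theory Num.Theory.
Import numFieldNormedType.Exports.
Local Open Scope classical_set_scope.
Local Open Scope ring_scope.

(* Nodes, time frames and matrix indices are numbered from 0.                 *)

Section TimeEvolvingNetwork.
Variables (R : realType) (n : nat).

(* Only the values of [weight] on edges are meaningful. *)
Record wdigraph := WDigraph {
  edge : rel 'I_n ;
  weight : 'I_n -> 'I_n -> R ;
  weight_gt0 : forall v w, edge v w -> 0 < weight v w }.

Definition adjacency (D : wdigraph) : 'M[R]_n :=
  \matrix_(v, w) if edge D v w then weight D v w else 0.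

Variables (N : nat) (G : 'I_N -> wdigraph).

Definition te_adjacency : 'M[R]_(\sum_(s < N) n) :=
  \mxblock_(r < N, s < N) if (r <= s)%N then adjacency (G s) else 0.

(* The position of node [i] in block [s]; see [block_indexE]. *)
Definition block_index (s : 'I_N) (i : 'I_n) : 'I_(\sum_(s < N) n) :=
  tagnat.Rank (p_ := fun=> n) s i.

Lemma block_indexE (s : 'I_N) (i : 'I_n) : block_index s i = (s * n + i)%N :> nat.
Proof.
rewrite /block_index tagnat.RankEsum sum_nat_const; congr (_ * _ + _)%N.
rewrite (@eq_card _ _ [set k : 'I_N | (k < s)%N]%SET); last first.
  by move=> k; rewrite !inE.
by rewrite -sum1dep_card -(big_ord_widen _ (fun=> 1%N) (ltnW (ltn_ord s)))
  sum1_card card_ord.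
Qed.

(* A candidate walk of length [k]: its nodes i_1 ... i_(k+1) and its time     *)
(* frames sigma_1 ... sigma_k.                                                *)
Definition prewalk (k : nat) : finType := (k.+1.-tuple 'I_n * k.-tuple 'I_N)%type.

Section Walk.
Variables (k : nat) (w : prewalk k).

Definition wframe (l : 'I_k) : 'I_N := tnth w.2 l.
Definition wsource (l : 'I_k) : 'I_n := tnth w.1 (widen_ord (leqnSn k) l).
Definition wtarget (l : 'I_k) : 'I_n := tnth w.1 (lift ord0 l).

(* Walks of the subnetwork (G_tau1, ..., G_tau2): its frames keep the         *)
(* numbering they have in the whole network.                                  *)
Definition is_walk (tau1 tau2 : 'I_N) : bool :=
  [&& sorted (fun s s' : 'I_N => (s <= s')%N) w.2,
      [forall l : 'I_k, (tau1 <= wframe l <= tau2)%N]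
    & [forall l : 'I_k, edge (G (wframe l)) (wsource l) (wtarget l)]].

Definition departs_from (i : 'I_n) : bool := tnth w.1 ord0 == i.

Definition walk_weight : R :=
  \prod_(l < k) weight (G (wframe l)) (wsource l) (wtarget l).

End Walk.

(* f-centrality, f(z) = \sum_k c_k z^k, in the subnetwork (G_tau1,...,G_tau2) *)
Definition fcentrality (c : nat -> R) (t : R) (tau1 tau2 : 'I_N) (i : 'I_n) :
    \bar R :=
  (\sum_(0 <= k <oo)
     (\sum_(w : prewalk k | is_walk w tau1 tau2 && departs_from w i)
        c k * t ^+ k * walk_weight w)%:E)%E.

End TimeEvolvingNetwork.

Section MatrixFunction.
Variables (R : realType).

Definition radius_of_convergence (c : nat -> R) : \bar R :=
  ereal_sup [set `|z|%:E | z in [set z : R | cvgn (pseries c z)]].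

(* Over the complex numbers: real matrices may have non-real eigenvalues.     *)
Definition spectral_radius (m : nat) (X : 'M[R]_m) : R :=
  sup [set Normc.normc z |
        z in [set z : R[i] | eigenvalue (map_mx (real_complex R) X) z]].

Definition mxseries (c : nat -> R) (m : nat) (X : 'M[R]_m) : nat -> 'M[R]_m :=
  [series c k *: X ^+ k]_k.

Definition mxfun (c : nat -> R) (m : nat) (X : 'M[R]_m) : 'M[R]_m :=
  limn (mxseries c X).

End MatrixFunction.

(* Main.v *)
Require Import Defs.
From HB Require Import structures.
From mathcomp Require Import all_boot all_order all_algebra.
From mathcomp Require Import all_classical all_reals all_analysis.
From mathcomp Require Import complex ring.
Set Implicit Arguments.
Unset Strict Implicit.
Unset Printing Implicit Defensive.
Import Order.TTheory GRing.Theory Num.Theory.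
Import numFieldNormedType.Exports.
Local Open Scope classical_set_scope.
Local Open Scope ring_scope.

(** The identity splits into an analytic and a combinatorial half.

Convergence. Write A for the block matrix and rho for its spectral radius.
Whenever rho < y, every entry of A^k is O(y^k) ([coord_expmx_le]). Instead
of a norm formula or a triangular form this uses the Cayley-Hamilton theorem:
over the complex numbers the product of the A - l, l ranging over the
eigenvalues, vanishes, so each entry of A^k satisfies a linear recurrence
which can be peeled off one eigenvalue at a time ([coord_mulmx_exp_le]). Since
t rho lies below the radius of convergence r of f, some x satisfies
t rho < x < r; taking y = x / t, the entrywise series are dominated by a
multiple of \sum_k c_k x^k ([cvg_mxseries]).

Combinatorics. Fix the last frame b. Removing the first step of a walk of length
k + 1 that starts at i and uses frames of [a, b] leaves a walk of length k that
uses frames of [s, b], where s is the frame of the removed step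
([walk_sumS]). The block row of A at frame a has the blocks A_s, s >= a, hence
the sum of the row (a, i) of A^k over the columns of frames at most b obeys the
same recurrence, and the two quantities agree ([sum_te_adjacency_exp]).

The theorem follows by multiplying with c_k t^k, summing over k, and exchanging
the limit with the finite sum over columns. *)

(** * Growth of the powers of a matrix *)

Lemma exprZ_mx (R : comPzRingType) (m : nat) (a : R) (A : 'M[R]_m) (k : nat) :
  (a *: A) ^+ k = a ^+ k *: A ^+ k.
Proof.
elim: k => [|k IHk]; first by rewrite !expr0 scale1r.
by rewrite !exprS IHk -!mulmxE -scalemxAl -scalemxAr scalerA.
Qed.

(** Induction on [s]. If B' = B (A - l), then B A^(k+1) = l B A^k + B' A^k, and
B' is killed by the remaining factors, so that the entries u_k of B A^k satisfy
|u_(k+1)| <= |l| |u_k| + C x^k. As |l| < x, such a sequence is O(x^k). *)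
Lemma coord_mulmx_exp_le (F : numFieldType) (m : nat) (A : 'M[F]_m.+1)
    (s : seq F) (x : F) (B : 'M[F]_m.+1) :
  (forall l, l \in s -> `|l| < x) ->
  B *m horner_mx A (\prod_(l <- s) ('X - l%:P)) = 0 ->
  forall i j, exists2 C, 0 <= C & forall k, `|(B *m A ^+ k) i j| <= C * x ^+ k.
Proof.
elim: s B => [|l s IHs] B sx; rewrite ?(big_nil, big_cons).
  rewrite rmorph1 mulmx1 => -> i j; exists 0 => // k.
  by rewrite mul0mx mxE normr0 mul0r.
rewrite rmorphM -mulmxE mulmxA rmorphB /= horner_mx_X horner_mx_C => B0 i j.
have [|C C0 leC] := IHs _ _ B0 i j.
  by move=> z zs; apply: sx; rewrite in_cons zs orbT.
have lx : `|l| < x by apply: sx; rewrite mem_head.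
have x0 : 0 <= x by apply: le_trans (ltW lx); exact: normr_ge0.
have xl0 : 0 < x - `|l| by rewrite subr_gt0.
(* C' bounds the term at k = 0, and it is large enough for
   |l| C' + C <= x C', which carries the bound from k to k + 1. *)
pose C' := `|B i j| + C / (x - `|l|).
have C'0 : 0 <= C' by rewrite addr_ge0// divr_ge0// ltW.
exists C' => //; elim=> [|k IHk].
  by rewrite expr0 mulmx1 mulr1 lerDl divr_ge0// ltW.
have -> : B *m A ^+ k.+1 = B *m (A - l%:M) *m A ^+ k + l *: (B *m A ^+ k).
  rewrite exprS -mulmxE mulmxA mulmxBr mulmxBl mul_mx_scalar -scalemxAl.
  by rewrite subrK.
rewrite mxE [X in _ + X]mxE (le_trans (ler_normD _ _))// normrM.
have -> : C' * x ^+ k.+1 = (x - `|l|) * C' * x ^+ k + `|l| * (C' * x ^+ k).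
  by rewrite exprS; ring.
rewrite lerD ?ler_wpM2l//; apply: le_trans (leC k) _.
rewrite ler_wpM2r ?exprn_ge0// mulrDr [_ * (C / _)]mulrC divfK ?gt_eqF//.
by rewrite lerDr mulr_ge0// ltW.
Qed.

Section SpectralRadius.
Variables (R : realType).

Lemma normcE (z : R[i]) : `|z| = (Normc.normc z)%:C%C.
Proof. by []. Qed.

(** The supremum defining the spectral radius is an upper bound because the
eigenvalues, being the roots of a polynomial, form a finite set. *)
Lemma normc_le_spectral_radius (m : nat) (X : 'M[R]_m) (z : R[i]) :
  eigenvalue (map_mx (real_complex R) X) z ->
  Normc.normc z <= spectral_radius X.
Proof.
move=> Xz; apply: ub_le_sup; last by exists z.
set p := char_poly (map_mx (real_complex R) X).
have [s ps] := closed_field_poly_normal p.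
exists (\sum_(w <- s) Normc.normc w) => _ [w + <-].
rewrite /= eigenvalue_root_char -/p ps (monicP (char_poly_monic _)) scale1r.
rewrite root_prod_XsubC => ws; rewrite (big_rem _ ws)/= lerDl sumr_ge0// => v _.
by have := normr_ge0 v; rewrite normcE lecR.
Qed.

(** A matrix of size 0 has no eigenvalue; its spectral radius is then
[sup set0 = 0]. *)
Lemma spectral_radius_ge0 (m : nat) (X : 'M[R]_m) : 0 <= spectral_radius X.
Proof.
rewrite /spectral_radius; set E := (X in sup X).
have [->|/set0P[_ [z zX _]]] := eqVneq E set0; first by rewrite sup0.
apply: le_trans (normc_le_spectral_radius zX).
by have := normr_ge0 z; rewrite normcE lecR.
Qed.

(** A weak form of Gelfand's formula, sufficient for comparison with a power
series: apply the previous bound to the roots of the complex characteristic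
polynomial, with B = 1. *)
Lemma coord_expmx_le (m : nat) (X : 'M[R]_m) (x : R) :
  spectral_radius X < x ->
  forall i j, exists C, forall k, `|(X ^+ k) i j| <= C * x ^+ k.
Proof.
case: m X => [|m] X rx; first by case.
move=> i j; set Y := map_mx (real_complex R) X.
have [s ps] := closed_field_poly_normal (char_poly Y).
move: ps; rewrite (monicP (char_poly_monic _)) scale1r => ps.
have [z zs||C C0 leC] := @coord_mulmx_exp_le _ _ Y s x%:C%C 1%:M _ _ i j.
- rewrite normcE ltcR; apply: le_lt_trans rx.
  by apply: normc_le_spectral_radius; rewrite eigenvalue_root_char ps
    root_prod_XsubC.
- by rewrite mul1mx -ps Cayley_Hamilton.
exists (complex.Re C) => k; have := leC k.
have CE : C = (complex.Re C)%:C%C by rewrite RRe_real// ger0_real.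
rewrite mul1mx -rmorphXn /= mxE -[_ ^+ k in X in _ <= X]rmorphXn CE -rmorphM /=.
by rewrite normc_def /= expr0n/= addr0 sqrtr_sqr lecR.
Qed.

End SpectralRadius.

(** * Convergence of the matrix power series *)

Lemma cvg_mx (K : numFieldType) (T : Type) (F : set_system T) (m n : nat)
    (f : T -> 'M[K]_(m, n)) (M : 'M[K]_(m, n)) :
  Filter F -> (forall i j, f x i j @[x --> F] --> M i j) -> f @ F --> M.
Proof.
move=> FF fM A [P M_P sPA].
suff : \forall x \near F, forall i j, P i j (f x i j).
  by apply: filterS => x Px; exact: sPA.
apply: filter_forall => i.
apply: (@filter_forall _ _ (fun j x => P i j (f x i j))) => j.
by apply: fM; exact: M_P.
Qed.

Lemma cvg_mx_coord (K : numFieldType) (T : Type) (F : set_system T) (m n : nat)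
    (f : T -> 'M[K]_(m, n)) (M : 'M[K]_(m, n)) i j :
  Filter F -> f @ F --> M -> f x i j @[x --> F] --> M i j.
Proof.
by move=> FF fM; exact: (cvg_comp _ _ fM (@coord_continuous K m n i j M)).
Qed.

Section MatrixSeries.
Variables (R : realType).

Lemma mxseries_coord (c : nat -> R) (m : nat) (X : 'M[R]_m) i j :
  (fun k => mxseries c X k i j) = series (fun k => c k * (X ^+ k) i j).
Proof.
apply/funext => k; rewrite /mxseries /series /= summxE.
by apply: eq_bigr => l _; rewrite mxE.
Qed.

(** Pick x strictly between t rho and the modulus of a point where the power
series converges. Since rho < x / t, the entries of (t X)^k are O(x^k), and
\sum_k c_k x^k converges. *)
Lemma cvg_mxseries (c : nat -> R) (m : nat) (X : 'M[R]_m) (t : R) :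
  (forall k, 0 <= c k) -> 0 < t ->
  ((t * spectral_radius X)%:E < radius_of_convergence c)%E ->
  cvgn (mxseries c (t *: X)).
Proof.
move=> c0 t0 /ereal_sup_gt[_ [z cz <-]]; rewrite lte_fin => tz.
have tn0 : t != 0 by rewrite gt_eqF.
have /midf_lt[tx xz] := tz; set x := (_ / 2) in tx xz.
have x0 : 0 <= x.
  by apply: le_trans (ltW tx); rewrite mulr_ge0 ?spectral_radius_ge0// ltW.
have ccx : cvgn (pseries c x).
  by apply: is_cvg_pseries_inside cz _; rewrite ger0_norm.
have rx : spectral_radius X < x / t by rewrite ltr_pdivlMr// mulrC.
have cvg_coord i j : cvgn (fun k => mxseries c (t *: X) k i j).
  rewrite mxseries_coord; have [C leC] := coord_expmx_le rx i j.
  apply: normed_cvg; apply: (@series_le_cvg _ _ (fun k => C * (c k * x ^+ k))).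
  - by move=> k; exact: normr_ge0.
  - move=> k; rewrite mulrCA mulr_ge0// -[x](divfK tn0) exprMn mulrA.
    by rewrite mulr_ge0 ?exprn_ge0 ?(ltW t0)// (le_trans _ (leC k)).
  - move=> k; rewrite /= exprZ_mx mxE normrM ger0_norm// mulrCA ler_wpM2l//.
    rewrite normrM ger0_norm ?exprn_ge0 ?(ltW t0)// mulrC.
    rewrite -[X in _ <= _ * X ^+ _](divfK tn0) exprMn mulrA.
    by rewrite ler_wpM2r ?exprn_ge0// ltW.
  - exact: is_cvg_seriesZ.
apply/cvg_ex; exists (\matrix_(i, j) limn (fun k => mxseries c (t *: X) k i j)).
by apply: cvg_mx => i j; rewrite mxE; exact: cvg_coord.
Qed.

(** When [rho = 0] the quotient is [+oo] and carries no information; the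
conclusion then reads [0 < r]. *)
Lemma lt_mul_of_lt_div (t rho : R) (r : \bar R) : 0 <= rho -> (0 < r)%E ->
  (t%:E < r / rho%:E -> (t * rho)%:E < r)%E.
Proof.
rewrite le_eqVlt => /predU1P[<- r0 _|rho0 _]; first by rewrite mulr0.
by rewrite inver gt_eqF// lte_pdivlMr// EFinM.
Qed.

End MatrixSeries.

(** * Walks and powers of the time-evolving adjacency matrix *)

Lemma forall_ord0 (P : pred 'I_0) : [forall l, P l].
Proof. by apply/forallP => -[]. Qed.

Lemma forall_ordS (k : nat) (P : pred 'I_k.+1) :
  [forall l, P l] = P ord0 && [forall l : 'I_k, P (lift ord0 l)].
Proof.
apply/forallP/andP => [Pl|[P0 /forallP PS] l]; last first.
  by case: (unliftP ord0 l) => [j|] ->.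
by split; [exact: Pl|apply/forallP].
Qed.

Section Walks.
Variables (R : realType) (n N : nat) (G : 'I_N -> wdigraph R n).
Local Notation A := (te_adjacency G).

Lemma te_adjacencyE (r s : 'I_N) (i j : 'I_n) :
  A (block_index r i) (block_index s j) =
  if (r <= s)%N then adjacency (G s) i j else 0.
Proof.
have /matrixP/(_ i j) := mxblockK (fun r s : 'I_N =>
  if (r <= s)%N then adjacency (G s) else 0) r s.
by rewrite mxE /te_adjacency => ->; case: ifP => //; rewrite mxE.
Qed.

Lemma sum_block_index (V : nmodType) (P : pred 'I_(\sum_(s < N) n))
    (F : 'I_(\sum_(s < N) n) -> V) :
  \sum_(l | P l) F l =
  \sum_(s < N) \sum_(j < n | P (block_index s j)) F (block_index s j).
Proof.
rewrite sig_big_dep (reindex (@tagnat.rank _ (fun=> n))); last first.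
  exact/onW_bij/tagnat.rank_bij.
by apply: eq_big => [[s j]|[s j] _].
Qed.

Lemma block_index_range (a b s : 'I_N) (j : 'I_n) :
  (n * a <= block_index s j < b.+1 * n)%N = (a <= s <= b)%N.
Proof.
have n0 : (0 < n)%N by apply: leq_ltn_trans (ltn_ord j).
have sj : ((s * n + j) %/ n = s)%N by rewrite divnMDl// divn_small ?addn0.
by rewrite block_indexE mulnC -leq_divRL// -ltn_divLR// sj ltnS.
Qed.

Definition walk_cons (k : nat) (i : 'I_n) (s : 'I_N) (w : prewalk n N k) :
    prewalk n N k.+1 :=
  ([tuple of i :: w.1], [tuple of s :: w.2]).

Lemma sum_prewalkS (V : nmodType) (k : nat) (F : prewalk n N k.+1 -> V) :
  \sum_w F w = \sum_i \sum_s \sum_w F (walk_cons i s w).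
Proof.
under [RHS]eq_bigr do rewrite pair_big.
rewrite pair_big /= (reindex (fun p : 'I_n * ('I_N * prewalk n N k) =>
  walk_cons p.1 p.2.1 p.2.2)) //=.
exists (fun w : prewalk n N k.+1 => (thead w.1,
  (thead w.2, ([tuple of behead w.1], [tuple of behead w.2])))).
  move=> [i [s [u v]]] _; rewrite /walk_cons /=.
  by congr (_, (_, (_, _))); apply/val_inj.
by move=> [u v] _; rewrite /walk_cons /= -!tuple_eta.
Qed.

Section Cons.
Variables (k : nat) (i : 'I_n) (s : 'I_N) (w : prewalk n N k).

Lemma departs_from_cons j : departs_from (walk_cons i s w) j = (i == j).
Proof. by rewrite /departs_from (tnth_nth i). Qed.

Lemma wframe_cons0 : wframe (walk_cons i s w) ord0 = s.
Proof. by rewrite /wframe (tnth_nth s). Qed.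

Lemma wframe_consS l : wframe (walk_cons i s w) (lift ord0 l) = wframe w l.
Proof. by rewrite /wframe !(tnth_nth s). Qed.

Lemma wsource_cons0 : wsource (walk_cons i s w) ord0 = i.
Proof. by rewrite /wsource (tnth_nth i). Qed.

Lemma wsource_consS l : wsource (walk_cons i s w) (lift ord0 l) = wsource w l.
Proof. by rewrite /wsource !(tnth_nth i). Qed.

Lemma wtarget_cons0 : wtarget (walk_cons i s w) ord0 = tnth w.1 ord0.
Proof. by rewrite /wtarget !(tnth_nth i). Qed.

Lemma wtarget_consS l : wtarget (walk_cons i s w) (lift ord0 l) = wtarget w l.
Proof. by rewrite /wtarget !(tnth_nth i). Qed.

Lemma walk_weight_cons : walk_weight G (walk_cons i s w) =
  weight (G s) i (tnth w.1 ord0) * walk_weight G w.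
Proof.
rewrite /walk_weight big_ord_recl wframe_cons0 wsource_cons0 wtarget_cons0.
by congr (_ * _); apply: eq_bigr => l _;
  rewrite wframe_consS wsource_consS wtarget_consS.
Qed.

(** Frames increase along a walk, so after a first step in frame [s] the lower
bound [a] on the remaining frames sharpens to [s]. *)
Lemma is_walk_cons a b : is_walk G (walk_cons i s w) a b =
  [&& (a <= s <= b)%N, edge (G s) i (tnth w.1 ord0) & is_walk G w s b].
Proof.
rewrite /is_walk !forall_ordS wframe_cons0 wsource_cons0 wtarget_cons0.
under eq_forallb do rewrite wframe_consS.
under [X in _ && (_ && (_ && X))]eq_forallb do
  rewrite wframe_consS wsource_consS wtarget_consS.
rewrite /= path_sortedE; last by move=> ? ? ?; exact: leq_trans.
case: (boolP (a <= s <= b)%N) => [/andP[as_ sb]|]; last by rewrite /= !andbF.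
case: (edge _ _ _); last by rewrite !andbF.
case: [forall l, edge _ _ _]; last by rewrite !andbF.
rewrite !andbT /= [all _ _ && _]andbC -andbA; congr (_ && _).
apply/andP/forallP => [[/all_tnthP sw /forallP wab] l|wsb].
  by have /andP[_ ->] := wab l; rewrite andbT; exact: sw.
split; first by apply/all_tnthP => l; have /andP[] := wsb l.
by apply/forallP => l; have /andP[sl ->] := wsb l; rewrite (leq_trans as_ sl).
Qed.

End Cons.

Definition walk_sum (k : nat) (a b : 'I_N) (i : 'I_n) : R :=
  \sum_(w : prewalk n N k | is_walk G w a b && departs_from w i)
    walk_weight G w.

Lemma walk_sum0 a b i : walk_sum 0 a b i = 1.
Proof.
rewrite /walk_sum (big_pred1 ([tuple i], [tuple])) => [|[u v]].
  by rewrite /walk_weight big_ord0.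
rewrite /is_walk /departs_from !forall_ord0 (tuple0 v) /=.
apply/eqP/eqP => [ui|[-> //]]; congr (_, _); apply/val_inj.
by rewrite -ui; case/tupleP: u {ui} => x u; rewrite (tuple0 u).
Qed.

(** Classify the walks of length k + 1 by the frame [s] and the target [j] of
their first step. *)
Lemma walk_sumS k a b i : walk_sum k.+1 a b i =
  \sum_(s < N | (a <= s <= b)%N) \sum_(j < n)
    adjacency (G s) i j * walk_sum k s b j.
Proof.
rewrite /walk_sum big_mkcond sum_prewalkS (bigD1 i)//=.
rewrite [X in _ + X]big1 ?addr0 => [|j ji]; last first.
  rewrite big1// => s _; rewrite big1// => w _.
  by rewrite departs_from_cons (negbTE ji) andbF.
rewrite [RHS]big_mkcond; apply: eq_bigr => s _.
case: ifPn => asb; last first.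
  by rewrite big1// => w _; rewrite is_walk_cons (negbTE asb).
under eq_bigr do
  rewrite is_walk_cons departs_from_cons eqxx andbT asb walk_weight_cons /=.
rewrite (partition_big (fun w => tnth w.1 ord0) xpredT)//=.
apply: eq_bigr => j _; rewrite mulr_sumr [RHS]big_mkcond [LHS]big_mkcond /=.
apply: eq_bigr => w _; rewrite /departs_from mxE.
case: eqP => [<-|_]; rewrite ?andbT ?andbF//.
by case: (edge _ _ _); case: (is_walk _ _ _ _); rewrite /= ?mul0r.
Qed.

(** Row sums of A^(k+1) and weights of walks satisfy the same recurrence. The
induction passes from frame [tau] to all later frames [s] while the range of
columns stays fixed, whence the separate lower end [a]: by block triangularity
the columns of frames before [tau] contribute nothing. Beyond [b] the row sum
vanishes, but [walk_sum] would still count the walk of length 0. *)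
Lemma sum_te_adjacency_exp k (a tau b : 'I_N) i : (a <= tau)%N ->
  \sum_(l < \sum_(s < N) n | (n * a <= l < b.+1 * n)%N)
    (A ^+ k) (block_index tau i) l =
  if (tau <= b)%N then walk_sum k tau b i else 0.
Proof.
elim: k a tau i => [|k IHk] a tau i a_tau.
  rewrite expr0; under eq_bigr do rewrite mxE.
  rewrite walk_sum0 big_mkcond (bigD1 (block_index tau i))//= eqxx.
  rewrite block_index_range a_tau big1 ?addr0; first by case: ifP.
  by move=> l /negbTE; rewrite eq_sym => ->; rewrite if_same.
under eq_bigr do rewrite exprS -mulmxE mxE.
rewrite exchange_big /=; under eq_bigr do rewrite -mulr_sumr.
rewrite sum_block_index walk_sumS.
transitivity (\sum_(s < N | (tau <= s <= b)%N) \sum_(j < n)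
    adjacency (G s) i j * walk_sum k s b j).
  rewrite [RHS]big_mkcond; apply: eq_bigr => s _.
  case: (leqP tau s) => /= tau_s; last first.
    by rewrite big1// => j _; rewrite te_adjacencyE leqNgt tau_s mul0r.
  have IHs j := IHk _ _ j (leq_trans a_tau tau_s).
  case: ifP IHs => _ IHs; last rewrite big1// => j _.
    by apply: eq_bigr => j _; rewrite te_adjacencyE tau_s IHs.
  by rewrite IHs mulr0.
case: leqP => // b_tau; rewrite big_pred0// => s; apply/negbTE/negP.
by case/andP => /leq_trans/[apply]; rewrite leqNgt b_tau.
Qed.

End Walks.

(** * The centrality of a subnetwork *)

(* The quotient is taken in \bar R, where x / 0 = +oo for 0 < x and
   +oo / x = +oo for 0 <= x. *)
Theorem theorem3p3 (R : realType) (n N : nat) (G : 'I_N -> wdigraph R n)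
    (c : nat -> R) (c_ge0 : forall k, 0 <= c k)
    (f_analytic : (0 < radius_of_convergence c)%E)
    (tau1 tau2 : 'I_N) (tau12 : (tau1 <= tau2)%N)
    (t : R) (t_gt0 : 0 < t)
    (t_lt : (t%:E < radius_of_convergence c /
                    (spectral_radius (te_adjacency G))%:E)%E) :
  cvgn (mxseries c (t *: te_adjacency G)) /\
  forall i : 'I_n,
    fcentrality G c t tau1 tau2 i =
    (\sum_(j < \sum_(s < N) n | (n * tau1 <= j < tau2.+1 * n)%N)
       mxfun c (t *: te_adjacency G) (block_index tau1 i) j)%:E.
Proof.
have lt_radius := lt_mul_of_lt_div (spectral_radius_ge0 _) f_analytic t_lt.
have cvgX := cvg_mxseries c_ge0 t_gt0 lt_radius; split=> // i.
set X := t *: te_adjacency G in cvgX *; set r := block_index tau1 i.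
rewrite /fcentrality.
(* The partial sums of the centrality are those of the finitely many matrix
   entries. *)
transitivity (limn (EFin \o (fun K => \sum_(j < \sum_(s < N) n |
    (n * tau1 <= j < tau2.+1 * n)%N) mxseries c X K r j))).
  congr (limn _); apply/funext => K; rewrite /= sumEFin; congr EFin.
  under [RHS]eq_bigr do rewrite summxE.
  rewrite exchange_big /=; apply: eq_bigr => k _.
  under [RHS]eq_bigr do rewrite mxE exprZ_mx mxE mulrA.
  by rewrite -!mulr_sumr sum_te_adjacency_exp// tau12.
apply: cvg_lim => //; apply: cvg_EFin; first by apply: nearW => K; exact: isT.
apply: cvg_big => [|j _]; first exact: add_continuous.
exact: cvg_mx_coord cvgX.
Qed.
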